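(* Let $G$ be a finite $2$-transitive permutation group on a set $X$ with a regular normal subgroup $N$, let $x\in X$ and $H=G_x$. Then the subgroup of $G$ generated by $\mathrm{Der}_G$ is equal to the subgroup generated by $N$ together with the two-point stabilizers $H_y=G_x\cap G_y$ for $y\in X$, $y\neq x$.
   Context: $\mathrm{Der}_G$ denotes the set of derangements (elements with no fixed point on $X$) of $G$. *)

(* Defs.v *)
From mathcomp Require Import all_boot all_fingroup all_solvable.

Set Implicit Arguments.
Unset Strict Implicit.
Unset Printing Implicit Defensive.

Local Open Scope group_scope.

Definition derangements (X : finType) (G : {set {perm X}}) : {set {perm X}} :=
  [set g in G | [forall z : X, g z != z]].

(* Distinct from the library's [semiregular], which concerns conjugation. *)
Definition regular_on (X : finType) (N : {set {perm X}}) : Prop :=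
  [transitive N, on [set: X] | 'P] /\ forall z : X, 'C_N[z | 'P] = 1.

(* Main.v *)
(** Let [N] be regular. For a permutation [h] and a point [z] exactly one element
    of the coset [h N] fixes [z], so the elements of [h N] have [#|X| = #|N|] fixed
    points in total, and [h N] contains a derangement iff one of its elements has
    two fixed points. Conjugating by an element of [N], which lies in both
    generated subgroups, moves one of these two points to [x]. *)
Require Import Defs.
From mathcomp Require Import all_boot all_fingroup all_solvable.

Local Open Scope group_scope.

Lemma in_astab1P (X : finType) (A : {set {perm X}}) (x : X) (g : {perm X}) :
  reflect (g \in A /\ g x = x) (g \in 'C_A[x | 'P]).
Proof.
apply: (iffP setIP) => -[gA gx]; split=> //; first exact: (astab1P gx).
exact/astab1P.
Qed.

Section Regular.

Set Implicit Arguments.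
Unset Strict Implicit.

Variables (X : finType) (N : {group {perm X}}).
Hypothesis N_regular : regular_on N.

Lemma regular_on_inj (m n : {perm X}) (z : X) :
  m \in N -> n \in N -> m z = n z -> m = n.
Proof.
move=> mN nN emn; case: N_regular => _ /(_ z) Cz.
have : m * n^-1 \in 'C_N[z | 'P].
  by apply/in_astab1P; rewrite groupM ?groupV // permM emn permK.
by rewrite Cz => /set1P/(canRL (mulgKV _)); rewrite mul1g.
Qed.

Lemma regular_on_move (y z : X) : exists2 n, n \in N & n y = z.
Proof.
case: N_regular => trN _.
have [n nN ->] := atransP2 trN (in_setT y) (in_setT z).
by exists n.
Qed.

Lemma card_regular_on (x : X) : #|N| = #|X|.
Proof.
case: N_regular => trN Cx.
have := card_orbit 'P N x; rewrite (atransP trN _ (in_setT x)) cardsT.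
by rewrite Cx indexg1.
Qed.

(** Let [f z] be the unique [n] in [N] such that [h * n] fixes [z]. Derangements in the coset are
    values missed by [f], and elements with two fixed points are collisions of [f]; since [X] and
    [N] have equal size, one occurs iff the other does. *)
Lemma coset_derangementP (x : X) (h : {perm X}) :
  (exists2 n, n \in N & forall z, (h * n) z != z) <->
  (exists2 n, n \in N & exists u v, [/\ u != v, (h * n) u = u & (h * n) v = v]).
Proof.
have exf z : exists n, (n \in N) && ((h * n) z == z).
  have [n nN nz] := regular_on_move (h z) z.
  by exists n; rewrite nN permM nz /=.
pose f z := xchoose (exf z).
have fN z : f z \in N by have /andP[] := xchooseP (exf z).
have fz z : (h * f z) z = z by have /andP[_ /eqP] := xchooseP (exf z).
have f_uniq n z : n \in N -> (h * n) z = z -> n = f z.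
  move=> nN nz; apply: (@regular_on_inj _ _ (h z)) => //.
  by rewrite -!permM nz fz.
have sub_fN : f @: [set: X] \subset N by apply/subsetP=> _ /imsetP[z _ ->].
split=> [[n nN der_n] | [n nN [u [v [neq_uv nu nv]]]]].
- have /injectivePn[u [v neq_uv fuv]] : ~~ injectiveb f.
    apply/negP => /injectiveP f_inj.
    have /eqP fX : f @: [set: X] == N.
      by rewrite eqEcard sub_fN card_imset // cardsT (card_regular_on x) /=.
    have : n \in f @: [set: X] by rewrite fX.
    by case/imsetP=> z _ n_fz; have := der_n z; rewrite n_fz fz eqxx.
  by exists (f u) => //; exists u, v; split=> //; rewrite fuv.
(* Both [u] and [v] are sent to [n] by [f], so [f] cannot be onto [N]; any missed [m] gives a
   derangement [h * m]. *)
- have /subsetPn[m mN m_notf] : ~~ (N \subset f @: [set: X]).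
    apply/negP => sNf; have fX : f @: [set: X] = N by apply/eqP; rewrite eqEsubset sub_fN.
    have /imset_injP f_inj : #|f @: [set: X]| == #|[set: X]|.
      by rewrite fX cardsT (card_regular_on x).
    by rewrite (f_inj u v) ?inE ?eqxx // -?(f_uniq n) in neq_uv.
  exists m => // z; apply: contraNneq m_notf => mz.
  by rewrite (f_uniq m z) ?imset_f ?inE.
Qed.

End Regular.

Theorem theorem5p5 (X : finType) (G N : {group {perm X}}) (x : X)
    (G_2trans : [transitive^2 G, on [set: X] | 'P])
    (N_normal : N <| G)
    (N_regular : regular_on N) :
  <<derangements G>> =
    <<N :|: \bigcup_(y : X | y != x) ('C_G[x | 'P] :&: 'C_G[y | 'P])>>.
Proof.
have sNG := normal_sub N_normal.
(* By regularity a nontrivial element of [N] agrees with the identity nowhere, so it is a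
   derangement. *)
have sND : N \subset <<derangements G>>.
  apply/subsetP=> n nN; have [-> | n_neq1] := eqVneq n 1; first exact: group1.
  apply: mem_gen; rewrite inE (subsetP sNG) //=; apply/forallP=> z.
  apply: contraNneq n_neq1 => nz; apply/eqP.
  by apply: (@regular_on_inj _ _ N_regular _ _ z); rewrite ?group1 ?perm1.
apply/eqP; rewrite eqEsubset !gen_subG; apply/andP; split.
- set K := generated_group _.
  have sNK : N \subset K by rewrite sub_gen ?subsetUl.
  apply/subsetP=> g /setIdP[gG /forallP der_g].
  (* The derangement in the coset of [g] is [g] itself. *)
  have [|k kN [u [v [neq_uv ku kv]]]] := (coset_derangementP N_regular x g).1.
    by exists 1; rewrite ?group1 ?mulg1.
  have [n nN nu] := regular_on_move N_regular u x.
  have nG := subsetP sNG n nN.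
  have gkG : g * k \in G by rewrite groupM // (subsetP sNG).
  (* As [n] sends [u] to [x], this conjugate fixes [x] and [n v], which differs from [x]. *)
  have gkK : (g * k) ^ n \in K.
    apply/mem_gen/setUP; right; apply/bigcupP; exists (n v).
      by rewrite -nu (inj_eq perm_inj) eq_sym.
    apply/setIP; split; apply/in_astab1P; rewrite groupJ //.
      by rewrite -nu permJ ku.
    by rewrite permJ kv.
  (* Both [n] and [k] lie in [K], so the conjugation and the factor [k] can be removed. *)
  have nK := subsetP sNK n nN; move: gkK; rewrite memJ_norm ?(subsetP (normG _)) //.
  by rewrite groupMr // (subsetP sNK).
- rewrite subUset sND /=; apply/bigcupsP=> y neq_yx; apply/subsetP=> h.
  case/setIP=> /in_astab1P[hG hx] /in_astab1P[_ hy].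
  (* Here [h] itself has the two fixed points [y] and [x]. The resulting derangement [h * n] puts
     [h] in the subgroup, which already contains [n]. *)
  have [|n nN der_hn] := (coset_derangementP N_regular x h).2.
    by exists 1; rewrite ?group1 // mulg1; exists y, x; split.
  rewrite -(groupMr _ (subsetP sND n nN)); apply: mem_gen.
  by rewrite inE groupM ?(subsetP sNG n nN) //=; apply/forallP.
Qed.
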